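(* Let $(r_n)_{n\ge 0}$ be a deterministic sequence with $0\le r_n<1$, and let $M=(M_n)_{n\ge 0}$ be a martingale with respect to a filtration $(\mathcal{G}_n)_{n\ge 0}$, taking values in $[0,1]$ and following the dynamics $$M_{n+1}=(1-r_n)M_n+r_nY_{n+1},\qquad n\ge 0,$$ where $Y_{n+1}$ is a random variable with values in $[0,1]$ and $E[Y_{n+1}\mid\mathcal{G}_n]=M_n$ a.s. Let $M_\infty$ be the almost sure limit of $(M_n)_n$. If $P(0<M_0<1)>0$ and $\sum_n r_n^2<+\infty$, then $$P(M_\infty=0)+P(M_\infty=1)<1.$$ *)

(* Defs.v *)
From HB Require Import structures.
From mathcomp Require Import all_boot all_order all_algebra.
From mathcomp Require Import all_classical all_reals all_analysis.

Set Implicit Arguments.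
Unset Strict Implicit.
Unset Printing Implicit Defensive.

Import Order.TTheory GRing.Theory Num.Theory.
Import numFieldNormedType.Exports.

Local Open Scope classical_set_scope.
Local Open Scope ring_scope.

Definition is_filtration (d : measure_display) (T : measurableType d)
    (G : nat -> set (set T)) : Prop :=
  [/\ forall n, sigma_algebra [set: T] (G n),
      forall n, G n `<=` @measurable d T
    & forall m n, (m <= n)%N -> G m `<=` G n].

(* [f] is measurable from the sub-sigma-algebra [G] to the Borel sets of [R];
   the library's [measurable_fun] only refers to the sigma-algebra carried by
   the type [T]. *)
Definition sub_measurable (d : measure_display) (T : measurableType d)
    (R : realType) (G : set (set T)) (f : T -> R) : Prop :=
  forall B : set R, measurable B -> G (f @^-1` B).

(* E[X | G] = Z a.s.: [Z] is a version of the conditional expectation of [X]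
   given the sub-sigma-algebra [G] (unique up to [P]-null sets). *)
Definition is_cond_expectation (d : measure_display) (T : measurableType d)
    (R : realType) (P : probability T R) (G : set (set T)) (X Z : T -> R) :
    Prop :=
  [/\ P.-integrable [set: T] (EFin \o X),
      P.-integrable [set: T] (EFin \o Z),
      sub_measurable G Z
    & forall A : set T, G A ->
        (\int[P]_(w in A) (Z w)%:E = \int[P]_(w in A) (X w)%:E)%E].

Definition is_martingale (d : measure_display) (T : measurableType d)
    (R : realType) (P : probability T R) (G : nat -> set (set T))
    (M : nat -> T -> R) : Prop :=
  [/\ forall n, sub_measurable (G n) (M n),
      forall n, P.-integrable [set: T] (EFin \o M n)
    & forall n, is_cond_expectation P (G n) (M n.+1) (M n)].

(* Main.v *)
Require Import Defs.
From HB Require Import structures.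
From mathcomp Require Import all_boot all_order all_algebra.
From mathcomp Require Import all_classical all_reals all_analysis.
From mathcomp Require Import measurable_realfun ring lra.
Import Order.TTheory GRing.Theory Num.Theory.
Import numFieldNormedType.Exports.

Local Open Scope classical_set_scope.
Local Open Scope ring_scope.

(** Put H_n = E[M_n (1 - M_n)]. Since E[Y_{n+1} | G_n] = M_n and Y^2 <= Y for
    Y in [0, 1], the dynamics give H_{n+1} >= (1 - r_n^2) H_n. As r_n < 1 and
    sum r_n^2 < oo, the product of the factors 1 - r_n^2 is positive, so H_n
    stays above some c > 0. If M_oo were a.s. in {0, 1}, dominated convergence
    would force H_n to tend to 0. *)

(** * Pulling a measurable factor out of a conditional expectation *)

(** The sum counts the integers among [1, ..., k] that are at most [x], so on [[0, k]] it is the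
    integer part of [x]. *)
Lemma staircase_dist (R : realFieldType) (k : nat) (x : R) :
  0 <= x <= k%:R -> `|x - \sum_(j < k) (j.+1%:R <= x)%R%:R| <= 1.
Proof.
have full m (y : R) : m%:R <= y -> \sum_(j < m) (j.+1%:R <= y)%R%:R = m%:R :> R.
  move=> my; rewrite (eq_bigr (fun=> 1)) ?sumr_const ?card_ord// => j _.
  by rewrite (le_trans _ my)// ler_nat.
elim: k => [|k IH] /andP[x0 xk].
  by rewrite big_ord0 subr0 ger0_norm// (le_trans xk).
rewrite big_ord_recr/=; have [kx|kx] := leP k.+1%:R x.
  rewrite full; last by rewrite (le_trans _ kx)// ler_nat.
  move: xk kx; rewrite -natr1 mulr1n ler_norml => xk kx; lra.
rewrite addr0; have [kx'|kx'] := leP k%:R x; last by rewrite IH// x0 ltW.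
by move: kx; rewrite full// -natr1 ler_norml; lra.
Qed.

Section bounded_integrals.
Context (R : realType) (d : measure_display) (T : measurableType d).
Variable P : probability T R.

Lemma integrable_le_bound (f : T -> R) (C : R) :
  measurable_fun [set: T] f -> (forall w, `|f w| <= C) ->
  P.-integrable [set: T] (EFin \o f).
Proof.
move=> mf fC; apply: measurable_bounded_integrable => //.
  by rewrite (le_lt_trans (probability_le1 P measurableT))// ltry.
exists C; split; first exact: num_real.
by move=> x Cx w _ /=; rewrite (le_trans (fC w))// ltW.
Qed.

(* [Z] is pulled out of the conditional expectation by approximating [k Z]
   within [1] by the sum of the indicators of the [G]-events [j + 1 <= k Z]. *)
Lemma cond_expectation_integralM_sub (G : set (set T)) (X Z : T -> R) :
  G `<=` @measurable d T ->
  is_cond_expectation P G X Z ->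
  (forall w, 0 <= X w <= 1) -> (forall w, 0 <= Z w <= 1) ->
  \int[P]_w (Z w * (X w - Z w)) = 0.
Proof.
move=> Gm [iX iZ GZ EZ] X01 Z01.
have mX : measurable_fun [set: T] X.
  by apply/measurable_EFinP; exact: measurable_int iX.
have mZ : measurable_fun [set: T] Z.
  by apply/measurable_EFinP; exact: measurable_int iZ.
have mW : measurable_fun [set: T] (fun w => X w - Z w) by exact: measurable_funB.
have W1 w : `|X w - Z w| <= 1.
  by have := X01 w; have := Z01 w; rewrite ler_norml; lra.
have indic0 (A : set T) : G A -> \int[P]_w (\1_A w * (X w - Z w)) = 0.
  move=> GA; transitivity (\int[P]_(w in A) (X w - Z w)).
    rewrite [RHS]Rintegral_mkcond patch_indic.
    by apply: eq_Rintegral => w _ /=; rewrite mulrC.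
  have mA := Gm _ GA.
  rewrite RintegralB//.
  - by rewrite /Rintegral EZ// subrr.
  - exact: integrableS iX.
  - exact: integrableS iZ.
(* The scale [k] and the number [m] of steps are kept apart, so that induction on [m] adds one
   [G]-event at a time. Only [m = k] is used in the end, since [k Z] lies in [[0, k]]. *)
pose s (k m : nat) w : R := \sum_(j < m) (j.+1%:R <= k%:R * Z w)%R%:R.
have sS k m w : s k m.+1 w = s k m w + (\1_[set v | m.+1%:R <= k%:R * Z v] w : R).
  rewrite /s big_ord_recr/= indicE; congr (_ + (nat_of_bool _)%:R).
  by apply/idP/idP; rewrite inE.
have GA k m : G [set v | m.+1%:R <= k%:R * Z v].
  apply: (GZ [set x | m.+1%:R <= k%:R * x]).
  rewrite (_ : [set x | _] = setT `&` (fun x => k%:R * x) @^-1` `[m.+1%:R, +oo[%classic).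
    have mk : measurable_fun [set: R] (fun x => k%:R * x) by exact: measurable_funM.
    exact: mk.
  by rewrite setTI; apply/seteqP; split => x /=; rewrite in_itv/= andbT.
have ms k m : measurable_fun [set: T] (s k m).
  elim: m => [|m IH].
    by rewrite (_ : s k 0%N = cst 0)//; apply/funext => w; rewrite /s big_ord0.
  rewrite (_ : s k m.+1 = s k m \+ \1_[set v | m.+1%:R <= k%:R * Z v]).
    by apply: measurable_funD => //; apply: measurable_indic; exact: Gm.
  by apply/funext => w; rewrite sS.
have s_bd k m w : `|s k m w| <= m%:R.
  rewrite ger0_norm ?sumr_ge0//.
  have -> : m%:R = \sum_(j < m) 1 :> R by rewrite sumr_const card_ord.
  by apply: ler_sum => j _; rewrite lern1 leq_b1.
have sW_bd k m w : `|s k m w * (X w - Z w)| <= m%:R.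
  by rewrite normrM -[leRHS]mulr1 ler_pM.
have isW k m : P.-integrable [set: T] (EFin \o (fun w => s k m w * (X w - Z w))).
  by apply: integrable_le_bound (sW_bd k m); exact: measurable_funM.
have sW0 k m : \int[P]_w (s k m w * (X w - Z w)) = 0.
  elim: m => [|m IH].
    rewrite (_ : (fun w => _) = cst 0) ?Rintegral_cst ?mul0r//.
    by apply/funext => w; rewrite /s big_ord0 mul0r.
  under eq_Rintegral do rewrite sS mulrDl.
  rewrite RintegralD//; first by rewrite IH indic0 ?addr0.
  apply: (@integrable_le_bound _ 1).
    by apply: measurable_funM => //; apply: measurable_indic; exact: Gm.
  by move=> w; rewrite normrM mulr_ile1// indicE; case: (_ \in _); rewrite ?normr0 ?normr1.
have ZW1 w : `|Z w * (X w - Z w)| <= 1.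
  by rewrite normrM mulr_ile1//; have /andP[? ?] := Z01 w; rewrite ger0_norm.
have iZW : P.-integrable [set: T] (EFin \o (fun w => Z w * (X w - Z w))).
  by apply: (@integrable_le_bound _ 1); first exact: measurable_funM.
set I := Rintegral _ _ _.
(* Subtracting the null integral [sW0 k k] turns [k I] into the integral of [(k Z - s k k) (X - Z)],
   whose two factors are at most 1 in absolute value. As [k] is arbitrary, [I = 0]. *)
have bound k : k%:R * `|I| <= 1.
  rewrite -(ger0_norm (ler0n R k)) -normrM.
  rewrite /I -RintegralZl// -[X in `|X|]subr0 -[X in _ - X](sW0 k k) -RintegralB//; last first.
    apply: (@integrable_le_bound _ k%:R) => [|w].
      by apply: measurable_funM => //; exact: measurable_funM.
    by rewrite normrM ger0_norm// -[leRHS]mulr1 ler_pM.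
  under eq_Rintegral do rewrite mulrA -mulrBl.
  have step w : `|(k%:R * Z w - s k k w) * (X w - Z w)| <= 1.
    rewrite normrM mulr_ile1//; apply: staircase_dist.
    by have /andP[? ?] := Z01 w; rewrite mulr_ge0//= -[leRHS]mulr1 ler_wpM2l.
  have mst : measurable_fun [set: T] (fun w => (k%:R * Z w - s k k w) * (X w - Z w)).
    by apply: measurable_funM => //; apply: measurable_funB => //; exact: measurable_funM.
  apply: le_trans (le_normr_Rintegral _ (integrable_le_bound _ _ mst step)) _ => //.
  apply: le_trans (_ : \int[P]_w 1 <= 1).
    apply: le_Rintegral => //; apply: (@integrable_le_bound _ 1) => //.
    - exact: measurableT_comp.
    - by move=> w; rewrite normr_id.
    - by move=> w; rewrite normr1.
  by rewrite Rintegral_cst//= probability_setT mul1r.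
apply/eqP/negPn/negP => I0.
have I0' : 0 < `|I| by rewrite normr_gt0.
have [k kI] : exists k : nat, `|I|^-1 < k%:R.
  by exists (Num.bound `|I|^-1); rewrite archi_boundP// invr_ge0 ltW.
by have := bound k; rewrite leNgt -ltr_pdivrMr// div1r kI.
Qed.

End bounded_integrals.

(** * One step of the dynamics *)

(** Expanding [M (1 - M)] around [Z] leaves [(1 - r ^+ 2) Z (1 - Z)], multiples of [X - Z] and
    [Z (X - Z)] that integrate to 0, and the nonnegative remainder [r ^+ 2 * (X (1 - X))]. *)
Lemma integral_mul1B_step_ge (R : realType) (d : measure_display)
    (T : measurableType d) (P : probability T R) (G : set (set T))
    (Z X M : T -> R) (r : R) :
  G `<=` @measurable d T -> G [set: T] -> is_cond_expectation P G X Z -> 0 <= r <= 1 ->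
  (forall w, 0 <= X w <= 1) -> (forall w, 0 <= Z w <= 1) ->
  measurable_fun [set: T] M ->
  {ae P, forall w, M w = (1 - r) * Z w + r * X w} ->
  (1 - r ^+ 2) * \int[P]_w (Z w * (1 - Z w)) <= \int[P]_w (M w * (1 - M w)).
Proof.
move=> Gm GT XZ /andP[r0 r1] X01 Z01 mM Mdyn.
have [iX iZ _ EZ] := XZ.
have mX : measurable_fun [set: T] X.
  by apply/measurable_EFinP; exact: measurable_int iX.
have mZ : measurable_fun [set: T] Z.
  by apply/measurable_EFinP; exact: measurable_int iZ.
pose N w := (1 - r) * Z w + r * X w.
have mN : measurable_fun [set: T] N.
  by apply: measurable_funD; exact: measurable_funM.
have N01 w : 0 <= N w <= 1.
  by have := X01 w; have := Z01 w; rewrite /N => ? ?; apply/andP; split; nra.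
(* The recursion holds only almost surely; [N] satisfies it everywhere, and as a convex combination
   it stays in [[0, 1]] everywhere. *)
have -> : \int[P]_w (M w * (1 - M w)) = \int[P]_w (N w * (1 - N w)).
  congr fine; apply: ae_eq_integral => //.
  - by apply/measurable_EFinP; apply: measurable_funM => //; exact: measurable_funB.
  - by apply/measurable_EFinP; apply: measurable_funM => //; exact: measurable_funB.
  - by apply: filterS Mdyn => w /= -> _.
have mD : measurable_fun [set: T] (fun w => X w - Z w) by exact: measurable_funB.
have iV (f : T -> R) : measurable_fun [set: T] f -> (forall w, 0 <= f w <= 1) ->
    P.-integrable [set: T] (EFin \o (fun w => f w * (1 - f w))).
  move=> mf f01; apply: (@integrable_le_bound _ _ _ _ _ 1).
    by apply: measurable_funM => //; exact: measurable_funB.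
  by move=> w; have := f01 w; rewrite ler_norml => ?; apply/andP; split; nra.
have iD : P.-integrable [set: T] (EFin \o (fun w => X w - Z w)).
  apply: (@integrable_le_bound _ _ _ _ _ 1) => // w.
  by have := X01 w; have := Z01 w; rewrite ler_norml; lra.
have iZD : P.-integrable [set: T] (EFin \o (fun w => Z w * (X w - Z w))).
  apply: (@integrable_le_bound _ _ _ _ _ 1); first exact: measurable_funM.
  by move=> w; have := X01 w; have := Z01 w; rewrite ler_norml => ? ?; apply/andP; split; nra.
have D0 : \int[P]_w (X w - Z w) = 0.
  by rewrite RintegralB// /Rintegral EZ// subrr.
have ZD0 : \int[P]_w (Z w * (X w - Z w)) = 0.
  exact: cond_expectation_integralM_sub XZ _ _.
(* [L] is [N (1 - N)] without its remainder [r ^+ 2 * (X (1 - X))]. *)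
pose L w := (1 - r ^+ 2) * (Z w * (1 - Z w)) +
  ((r - r ^+ 2) * (X w - Z w) - 2 * (r - r ^+ 2) * (Z w * (X w - Z w))).
have iZl (c : R) (f : T -> R) : P.-integrable [set: T] (EFin \o f) ->
    P.-integrable [set: T] (EFin \o (fun w => c * f w)).
  by move=> iF; exact: (integrableZl _ _ iF).
have iVZ := iZl (1 - r ^+ 2) _ (iV Z mZ Z01).
have irD := iZl (r - r ^+ 2) _ iD.
have irZD := iZl (2 * (r - r ^+ 2)) _ iZD.
have iDD : P.-integrable [set: T] (EFin \o (fun w =>
    (r - r ^+ 2) * (X w - Z w) - 2 * (r - r ^+ 2) * (Z w * (X w - Z w)))).
  exact: (integrableB _ irD irZD).
have -> : (1 - r ^+ 2) * \int[P]_w (Z w * (1 - Z w)) = \int[P]_w L w.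
  rewrite RintegralD// RintegralB// !RintegralZl//; last exact: iV.
  by rewrite D0 ZD0 !mulr0 subrr addr0.
apply: le_Rintegral => //; first exact: (integrableD _ iVZ iDD).
  exact: iV.
move=> w _; rewrite -subr_ge0.
have -> : N w * (1 - N w) - L w = r ^+ 2 * (X w * (1 - X w)).
  by rewrite /N /L; ring.
by have /andP[? ?] := X01 w; rewrite !mulr_ge0// subr_ge0.
Qed.

(** * Positivity of sequences and of integrals *)

(** Beyond a rank [N] where the tail of the series is below 1/2, the product of the factors
    [1 - a k] is at least 1/2; the finitely many earlier factors are positive, so [h N > 0] and
    [c = h N / 2] works. *)
Lemma decay_lower_bound (R : realType) (a h : nat -> R) :
  (forall n, 0 <= a n < 1) -> (\sum_(0 <= n <oo) (a n)%:E < +oo)%E ->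
  0 < h 0%N -> (forall n, (1 - a n) * h n <= h n.+1) ->
  exists c, 0 < c /\ \forall n \near \oo, c <= h n.
Proof.
move=> a01 asum h0 hS.
have hpos n : 0 < h n.
  elim: n => // n IH; apply: lt_le_trans (hS n).
  by rewrite mulr_gt0// subr_gt0; have /andP[] := a01 n.
have age0 n : (0 <= (a n)%:E)%E by rewrite lee_fin; have /andP[] := a01 n.
have tail0 := nneseries_tail_cvg asum (fun n _ => age0 n).
have [tail_fin tail_cvg] := (fine_cvgP _ _).1 tail0.
have tail_lt : \forall n \near \oo, fine (\sum_(n <= k <oo) (a k)%:E)%E < 2^-1.
  by apply: (cvgr_lt _ tail_cvg); rewrite invr_gt0.
have [N _ /(_ N (leqnn N))/= [finN ltN]] := filterI tail_fin tail_lt.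
have partial n : \sum_(N <= k < n) a k <= 2^-1.
  rewrite -lee_fin -sumEFin; apply: (@le_trans _ _ (\sum_(N <= k <oo) (a k)%:E)%E).
    exact: nneseries_lim_ge.
  by rewrite -(fineK finN) lee_fin ltW.
exists (h N / 2); split; first by rewrite divr_gt0.
exists N => // n /= Nn.
(* The Weierstrass inequality for the product of the [1 - a k], unfolded along [hS]. *)
suff weier : (1 - \sum_(N <= k < n) a k) * h N <= h n.
  apply: le_trans weier; rewrite mulrC ler_pM2r//.
  have := partial n; lra.
rewrite -(subnKC Nn); elim: (n - N)%N => [|m IH].
  by rewrite addn0 big_geq// subr0 mul1r.
rewrite addnS big_nat_recr/= ?leq_addr//.
apply: le_trans (hS _).
set S := \sum_(_ <= _ < _) _ in IH *.
have S0 : 0 <= S by apply: sumr_ge0 => k _; have /andP[] := a01 k.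
have /andP[aN0 aN1] := a01 (N + m)%N.
(* With [a = a (N + m)], the product [(1 - a) (1 - S)] exceeds [1 - (S + a)] by [a S >= 0]. *)
apply: (@le_trans _ _ ((1 - a (N + m)%N) * ((1 - S) * h N))).
  by rewrite mulrA ler_pM2r//; nra.
by rewrite ler_wpM2l// subr_ge0 ltW.
Qed.

Lemma Rintegral_gt0 (R : realType) (d : measure_display)
    (T : measurableType d) (mu : {measure set T -> \bar R}) (f : T -> R) :
  mu.-integrable [set: T] (EFin \o f) -> (forall w, 0 <= f w) ->
  (0 < mu [set w | (0 < f w)%R])%E -> 0 < \int[mu]_w f w.
Proof.
move=> fi f0 fpos; rewrite lt_neqAle Rintegral_ge0// andbT.
apply/negP => /eqP int0.
have mf : measurable_fun [set: T] (EFin \o f) by exact: measurable_int fi.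
(* [fine] also sends infinite values to 0, so integrability is what makes the extended integral
   itself vanish. Then [f] is zero off a null set, which must contain the event [0 < f]. *)
have : (\int[mu]_w `|(EFin \o f) w|)%E = 0%E.
  under eq_integral => w _ do rewrite gee0_abs ?lee_fin//.
  by rewrite -(fineK (integrable_fin_num measurableT fi)) -[fine _]int0.
move=> /(ae_eq_integral_abs mu measurableT mf) [N [mN N0 fN]].
suff : (mu [set w | (0 < f w)%R] <= 0)%E by rewrite leNgt fpos.
rewrite -N0 le_measure// ?inE//.
  rewrite -[X in measurable X]setTI.
  rewrite (_ : [set w | _] = f @^-1` `]0, +oo[%classic); last first.
    by apply/seteqP; split => w /=; rewrite in_itv/= andbT.
  by have /measurable_EFinP mf' := mf; exact: mf'.
by apply: subset_trans fN => w /= fw /(_ I) [] fw0; rewrite fw0 ltxx in fw.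
Qed.

(** * The limit is not almost surely in [{0, 1}] *)

Theorem proposition2p6 (R : realType) (d : measure_display)
    (T : measurableType d) (P : probability T R)
    (G : nat -> set (set T)) (r : nat -> R)
    (M Y : nat -> {RV P >-> R}) (Minf : {RV P >-> R})
    (hr : forall n, 0 <= r n < 1)
    (hG : is_filtration G)
    (hM : is_martingale P G (fun n => M n))
    (hM01 : forall n w, 0 <= M n w <= 1)
    (hY01 : forall n w, 0 <= Y n.+1 w <= 1)
    (hdyn : forall n, {ae P, forall w,
       M n.+1 w = (1 - r n) * M n w + r n * Y n.+1 w})
    (hY : forall n, is_cond_expectation P (G n) (Y n.+1) (M n))
    (hMinf : {ae P, forall w, M n w @[n --> \oo] --> Minf w})
    (hM0 : (0 < P [set w | (0 < M 0%N w < 1)%R])%E)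
    (hsum : (\sum_(0 <= n <oo) ((r n) ^+ 2)%:E < +oo)%E) :
  (P [set w | Minf w = 0%R] + P [set w | Minf w = 1%R] < 1)%E.
Proof.
have [Gsig Gm _] := hG.
have GT n : G n [set: T].
  by have [G0 GC _] := Gsig n; rewrite -(setD0 [set: T]); exact: GC.
pose V (f : T -> R) w := f w * (1 - f w).
have mV (f : {RV P >-> R}) : measurable_fun [set: T] (V f).
  by apply: measurable_funM => //; exact: measurable_funB.
pose h n := \int[P]_w V (M n) w.
have V01 n w : 0 <= V (M n) w <= 1.
  by have := hM01 n w; rewrite /V => ?; apply/andP; split; nra.
have h0 : 0 < h 0%N.
  apply: Rintegral_gt0.
  - apply: (@integrable_le_bound _ _ _ _ _ 1) => // w.
    by have /andP[? ?] := V01 0%N w; rewrite ger0_norm.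
  - by move=> w; have /andP[] := V01 0%N w.
  (* For values in [[0, 1]], [V] is positive exactly in the open interval. *)
  - rewrite (_ : [set w | _] = [set w | (0 < M 0%N w < 1)%R])//.
    apply/seteqP; split => w /=; have := hM01 0%N w; rewrite /V => Mw.
      by move=> MV; apply/andP; split; nra.
    by move=> /andP[? ?]; rewrite mulr_gt0// subr_gt0.
have [c [c0 hc]] : exists c, 0 < c /\ \forall n \near \oo, c <= h n.
  apply: (decay_lower_bound _ (fun n => r n ^+ 2)) => //.
  - move=> n; have /andP[? ?] := hr n.
    by rewrite sqr_ge0 expr_lt1.
  - move=> n; apply: (integral_mul1B_step_ge _ _ _ _ _ _ (Y n.+1) _ (r n) (Gm n) (GT n)) => //.
    by have /andP[? ?] := hr n; apply/andP; split => //; exact: ltW.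
rewrite ltNge; apply/negP => sum_ge1.
(* The events [Minf = 0] and [Minf = 1] are disjoint, so by [sum_ge1] their union has probability at
   least 1 and its complement is null; [V Minf] vanishes on the union. *)
have V0 : {ae P, forall w, V Minf w = 0}.
  have mA x : measurable [set w | Minf w = x].
    exact: (measurable_funPTI Minf (measurable_set1 x)).
  exists (~` ([set w | Minf w = 0] `|` [set w | Minf w = 1])); split.
  - by apply: measurableC; exact: measurableU.
  - apply/eqP; rewrite eq_le measure_ge0 andbT probability_setC; last exact: measurableU.
    rewrite sube_le0 measureU//.
    by rewrite -subset0 => w [/= -> /eqP]; rewrite eq_sym oner_eq0.
  - by apply: subsetC => w [] /=; rewrite /V => ->; rewrite ?mul0r// subrr mulr0.
have [_ _ /= cvgV] : [/\ P.-integrable [set: T] (EFin \o V Minf),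
    [sequence (\int[P]_w `|(V (M n) w)%:E - (V Minf w)%:E|)%E]_n @ \oo --> 0%E &
    [sequence (\int[P]_w (V (M n) w)%:E)%E]_n @ \oo --> (\int[P]_w (V Minf w)%:E)%E].
  apply: (@dominated_convergence _ _ _ P _ _ (fun n => EFin \o V (M n))
    (EFin \o V Minf) (cst 1%E)) => //.
  - by move=> n; apply/measurable_EFinP.
  - exact/measurable_EFinP.
  - apply: filterS hMinf => w /= cM _.
    apply: cvg_EFin; first exact: nearW.
    by apply: cvgM => //; apply: cvgB => //; exact: cvg_cst.
  - by apply: (@integrable_le_bound _ _ _ _ (cst 1) 1) => // w; rewrite normr1.
  - apply: aeW => w n _ /=; rewrite lee_fin.
    by have /andP[? ?] := V01 n w; rewrite ger0_norm.
(* The limit integral is 0 by [V0], so [h n] falls below [c] eventually, against [hc]. *)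
have [_ /(cvgr_lt _)/(_ c c0) hlt] :
    (\forall n \near \oo, (\int[P]_w (V (M n) w)%:E)%E \is a fin_num) /\
    h n @[n --> \oo] --> 0.
  apply/fine_cvgP; rewrite (_ : 0%:E = (\int[P]_w (V Minf w)%:E)%E)//.
  transitivity (\int[P]_w (cst 0 w))%E; first by rewrite integral0.
  apply: ae_eq_integral => //; first exact/measurable_EFinP.
  by apply: filterS V0 => w /= -> _.
have [n [/= hn1 hn2]] := filter_ex (filterI hc hlt).
by move: hn2; rewrite ltNge hn1.
Qed.
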